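(* Let $n>2$ and let $C$ be a compact convex subset of $\mathbb{R}^n$ with the following property: for every centrally symmetric compact convex subset $B\subset\mathbb{R}^n$ and every translate $C+u$ ($u\in\mathbb{R}^n$) of $C$ with $C+u\subseteq B$, the translate $C+u$ is parkable in $B$. Then $C$ has a center of symmetry.
   Context: Let $C\subseteq B$ be convex subsets of $\mathbb{R}^n$ with $0\in B$. $C$ is parkable in $B$ if some translate of $C$ is contained in $B$ and contains $0$, i.e. there is $v\in\mathbb{R}^n$ with $0\in C+v\subseteq B$. A center of symmetry for a convex set $C\subseteq\mathbb{R}^n$ is a point $p\in C$ such that $C=2p-C:=\{2p-x\mid x\in C\}$. $C$ has a center of symmetry if such a point exists. $C$ is centrally symmetric if $0\in C$ and $0$ is a center of symmetry for $C$ (so $C=-C$). *)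

(* Defs.v *)
From mathcomp Require Import all_boot all_order all_algebra.
From mathcomp Require Import all_classical all_reals all_analysis.

Set Implicit Arguments.
Unset Strict Implicit.
Unset Printing Implicit Defensive.

Import GRing.Theory.

Local Open Scope classical_set_scope.
Local Open Scope ring_scope.

Section Parking.
Context {V : zmodType}.
Implicit Types (B C : set V) (p u : V).

Definition translate C u : set V := [set x + u | x in C].

(* Meant for convex sets [C `<=` B] with [B 0]; these are not part of the
   definition and have to be assumed where it is used. *)
Definition parkable C B : Prop :=
  exists v, translate C v 0 /\ translate C v `<=` B.

Definition center_of_symmetry C p : Prop :=
  C p /\ C = [set p *+ 2 - x | x in C].

Definition has_center_of_symmetry C : Prop :=
  exists p, center_of_symmetry C p.

Definition centrally_symmetric C : Prop := center_of_symmetry C 0.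

End Parking.

(* Main.v *)
(* Let h be the support function of C. The smallest symmetric convex body
   containing C + u has support function max(h(y) + u.y, h(-y) - u.y).  Push C
   to infinity along w <> 0, that is, take u = t w with t large: parking says
   that C - c lies in this body for some c in C.  Testing this in a direction
   y + l w with y orthogonal to w, where l = O(1/t) makes the two terms of the
   maximum nearly equal, gives
     h(y) <= c.y + (h(y) + h(-y)) / 2 + O(1/t),
   and the same for -y, so that h(y) - h(-y) = 2 c.y + O(1/t): the projection
   of C along w is centrally symmetric.  Letting t grow, h(y) - h(-y) is linear
   in y on the orthogonal complement of w.  As n > 2, any two vectors are
   orthogonal to a common w, so h(y) - h(-y) = 2 p.y for some p and all y, and
   separating hyperplanes show that p is a center of symmetry. *)
Require Import Defs.
From mathcomp Require Import all_boot all_order all_algebra.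
From mathcomp Require Import all_classical all_reals all_analysis.
From mathcomp Require Import lra ring.
Import numFieldNormedType.Exports.
Import Order.TTheory GRing.Theory Num.Theory.

Local Open Scope classical_set_scope.
Local Open Scope ring_scope.

(** * The standard inner product on row vectors *)

Section DotProduct.
Context {R : realType} {n : nat}.
Implicit Types (x y z w : 'rV[R]_n) (a : R).

Definition dot x y : R := \sum_i x 0 i * y 0 i.

Lemma dotC x y : dot x y = dot y x.
Proof. by apply: eq_bigr => i _; rewrite mulrC. Qed.

Lemma dotDl x y z : dot (x + y) z = dot x z + dot y z.
Proof. by rewrite -big_split; apply: eq_bigr => i _; rewrite mxE mulrDl. Qed.

Lemma dotDr x y z : dot z (x + y) = dot z x + dot z y.
Proof. by rewrite !(dotC z) dotDl. Qed.

Lemma dotZl a x y : dot (a *: x) y = a * dot x y.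
Proof. by rewrite big_distrr; apply: eq_bigr => i _; rewrite mxE /= mulrA. Qed.

Lemma dotZr a x y : dot x (a *: y) = a * dot x y.
Proof. by rewrite !(dotC x) dotZl. Qed.

Lemma dotNl x y : dot (- x) y = - dot x y.
Proof. by rewrite -scaleN1r dotZl mulN1r. Qed.

Lemma dotNr x y : dot x (- y) = - dot x y.
Proof. by rewrite !(dotC x) dotNl. Qed.

Lemma dot0l y : dot 0 y = 0.
Proof. by rewrite -(scale0r 0) dotZl mul0r. Qed.

Lemma dot_delta x i : dot x (delta_mx 0 i) = x 0 i.
Proof.
rewrite /dot (bigD1 i)//= mxE !eqxx mulr1 big1 ?addr0// => j ji.
by rewrite mxE (negbTE ji) mulr0.
Qed.

Definition dotE := (dotDl, dotDr, dotNl, dotNr, dotZl, dotZr).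

Lemma dot_ge0 x : 0 <= dot x x.
Proof. by apply: sumr_ge0 => i _; rewrite -expr2 sqr_ge0. Qed.

Lemma dot_gt0 x : x != 0 -> 0 < dot x x.
Proof.
move=> x0; rewrite lt_neqAle dot_ge0 andbT eq_sym; apply: contra x0.
rewrite psumr_eq0 => [/allP xx0|i _]; last by rewrite -expr2 sqr_ge0.
apply/eqP/rowP => i; rewrite mxE; apply/eqP.
by have := xx0 i (mem_index_enum i); rewrite mulf_eq0 orbb.
Qed.

Lemma dot_sqrB a x y :
  dot (a *: x - y) (a *: x - y) =
  a ^+ 2 * dot x x - 2 * a * dot x y + dot y y.
Proof. by rewrite !dotE (dotC y x); ring. Qed.

Lemma continuous_dot (T : topologicalType) (f g : T -> 'rV[R]_n) :
  continuous f -> continuous g -> continuous (fun t => dot (f t) (g t)).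
Proof.
move=> cf cg; apply: continuous_big => [|i _ t]; first exact: add_continuous.
have coord (h : T -> 'rV[R]_n) :
    continuous h -> {for t, continuous (fun t => h t 0 i)}.
  move=> /(_ t) ch; apply: (@continuous_comp _ _ _ h (fun v => v 0 i)) => //.
  exact: coord_continuous.
by apply: cvgM; exact: coord.
Qed.

(** The matrix with columns [y] and [z] has rank at most 2, so its left kernel is nonzero. *)
Lemma orthogonal_vector_exists y z : (2 < n)%N ->
  exists w, [/\ w != 0, dot y w = 0 & dot z w = 0].
Proof.
move=> n2; pose A : 'M[R]_(n, 1 + 1) := row_mx y^T z^T.
have : kermx A != 0.
  rewrite -mxrank_eq0 mxrank_ker subn_eq0 -ltnNge.
  by rewrite (leq_ltn_trans (rank_leq_col A)).
case/rowV0Pn => w /sub_kermxP; rewrite mul_mx_row => wA w0.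
exists w; split=> //.
- have /matrixP/(_ 0 0) := congr1 lsubmx wA; rewrite row_mxKl !mxE => <-.
  by apply: eq_bigr => i _; rewrite mxE mulrC.
- have /matrixP/(_ 0 0) := congr1 rsubmx wA; rewrite row_mxKr !mxE => <-.
  by apply: eq_bigr => i _; rewrite mxE mulrC.
Qed.

End DotProduct.

(** * Separation of a point from a compact convex set *)

Section ConvexSets.
Context {R : realType} {n : nat}.
Implicit Types (x y z w : 'rV[R]_n) (C : set 'rV[R]_n).

Lemma convex_setP C :
  convex_set C <-> forall x y (t : R), C x -> C y -> 0 <= t <= 1 ->
    C (t *: x + (1 - t) *: y).
Proof.
split=> [cC x y t Cx Cy /andP[t0 t1]|cC x y t].
  have := cC x y (Itv01 t0 t1).
  by rewrite !inE; exact.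
rewrite !inE => Cx Cy; apply: cC => //.
by apply/andP; split; [exact: ge0|exact: le1].
Qed.

(** The normal is [z - q], with [q] a point of [C] nearest to [z]: moving from [q] towards another
    point of [C] cannot bring one closer to [z]. *)
Lemma separating_hyperplane C z :
  compact C -> convex_set C -> C !=set0 -> ~ C z ->
  exists y r, (forall x, C x -> dot x y <= r) /\ r < dot z y.
Proof.
move=> cC /convex_setP convC C0 Cz.
have cf : continuous (fun x => dot (x - z) (x - z)).
  have cB : continuous (fun x : 'rV[R]_n => x - z).
    by move=> x; apply: continuousB; [exact: cvg_id|exact: cst_continuous].
  exact: continuous_dot.
have [q] := @EVT_min_rV R n _ C C0 cC (continuous_subspaceT cf).
rewrite inE => Cq qmin.
have yy : 0 < dot (z - q) (z - q).
  by apply: dot_gt0; rewrite subr_eq0; apply/eqP => zq; apply: Cz; rewrite zq.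
exists (z - q), (dot q (z - q)); split; last first.
  by rewrite -subr_gt0 -dotNl -dotDl.
move=> x Cx; rewrite -subr_le0 -dotNl -dotDl leNgt; apply/negP.
set a := dot _ _ => a0.
have near t : 0 <= t <= 1 -> 2 * a * t <= t ^+ 2 * dot (x - q) (x - q).
  move=> t01; have := qmin (t *: x + (1 - t) *: q).
  rewrite inE => /(_ (convC _ _ _ Cx Cq t01)).
  have -> : t *: x + (1 - t) *: q - z = t *: (x - q) - (z - q).
    by apply/rowP => i; rewrite !mxE; ring.
  rewrite -(opprB z q) dotNl dotNr opprK.
  rewrite dot_sqrB -/a; lra.
have := near 1; rewrite ler01 lexx => /(_ isT).
set b := dot _ _ in near * => ab.
have b0 : 0 < b by lra.
(* [a / b] minimizes [t ^+ 2 * b - 2 * a * t], with a negative value if [0 < a]; the case [t = 1]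
   ensures that it lies in the unit interval. *)
have := near (a / b).
set k := a / b; have kE: k * b = a by rewrite divfK ?gt_eqF.
have k0 : 0 < k by rewrite divr_gt0.
have k1 : k <= 1 by rewrite ler_pdivrMr// mul1r; lra.
rewrite (ltW k0) k1 expr2 -(mulrA k) kE => /(_ isT); have := mulr_gt0 k0 a0; lra.
Qed.

End ConvexSets.

(** * Support functions and a criterion for a center of symmetry *)

Section SupportFunction.
Context {R : realType} {n : nat}.
Implicit Types (u x y z w : 'rV[R]_n) (C : set 'rV[R]_n).

Definition support C y : R := sup [set dot x y | x in C].

Lemma le_support C x y : compact C -> C x -> dot x y <= support C y.
Proof.
move=> cC Cx; apply: sup_upper_bound; last by exists x.
apply: compact_has_sup; first by exists (dot x y), x.
apply: continuous_compact => //; apply: continuous_subspaceT.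
by apply: continuous_dot => z; [exact: cvg_id|exact: cst_continuous].
Qed.

Lemma support_le C y r :
  C !=set0 -> (forall x, C x -> dot x y <= r) -> support C y <= r.
Proof.
move=> [x Cx] Cr; apply: ge_sup; first by exists (dot x y), x.
by move=> _ [z Cz <-]; exact: Cr.
Qed.

(** An intersection of closed half-spaces is closed and convex; the coordinate directions confine it
    to a box. *)
Lemma halfspace_body (S : 'rV[R]_n -> R) :
  (forall y, 0 <= S y) -> (forall y, S (- y) = S y) ->
  let B := [set z | forall y, dot z y <= S y] in
  [/\ compact B, convex_set B & centrally_symmetric B].
Proof.
move=> S0 SN B.
have BN z : B z -> B (- z).
  by move=> Bz y; rewrite dotNl -dotNr -SN; exact: Bz.
split.
- have box := @rV_compact R n
    (fun i => `[- S (delta_mx 0 i), S (delta_mx 0 i)]%classic)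
    (fun i => @segment_compact R _ _).
  apply: subclosed_compact box _ => [|z Bz i].
    have -> : B = \bigcap_(y in setT) [set z | dot z y <= S y].
      by apply/seteqP; split=> z Bz y => [_|]; exact: Bz.
    apply: closed_bigI => y _.
    apply: (@preimage_closed _ R (fun z => dot z y) [set r | r <= S y]) => //.
    move=> z _; apply: continuous_dot => x; [exact: cvg_id|exact: cst_continuous].
  rewrite /= in_itv /= -!dot_delta Bz andbT -[in leRHS](opprK z) dotNl lerN2.
  exact: BN.
- apply/convex_setP => x z t Bx Bz /andP[t0 t1] y; rewrite !dotE.
  rewrite [leRHS](_ : _ = t * S y + (1 - t) * S y); last by ring.
  by rewrite lerD// ler_wpM2l ?subr_ge0.
- split; first by move=> y; rewrite dot0l.
  apply/seteqP; split=> z; rewrite mul0rn.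
    by move=> Bz; exists (- z); [exact: BN|rewrite sub0r opprK].
  by case=> x Bx <-; rewrite sub0r; exact: BN.
Qed.

Lemma support_subN_ge0 C y :
  compact C -> C !=set0 -> 0 <= support C y + support C (- y).
Proof.
move=> cC [x Cx].
have := le_support _ _ y cC Cx; have := le_support _ _ (- y) cC Cx.
rewrite dotNr; lra.
Qed.

(** Twice the odd part of the support function. *)
Definition skewness C y : R := support C y - support C (- y).

Lemma skewnessN C y : skewness C (- y) = - skewness C y.
Proof. by rewrite /skewness opprK opprB. Qed.

(** If [p *+ 2 - x] were outside [C], a separating direction [y] would give
    [support C y < 2 * dot p y - dot x y], which is at most [2 * dot p y + support C (- y)]. *)
Lemma linear_skewness_center C p : compact C -> convex_set C -> C !=set0 ->
  (forall y, skewness C y = 2 * dot p y) -> has_center_of_symmetry C.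
Proof.
move=> cC convC C0 Cp.
have reflC x : C x -> C (p *+ 2 - x).
  move=> Cx; apply: contrapT => /(separating_hyperplane _ _ cC convC C0).
  case=> y [r [Cr]]; rewrite -scaler_nat !dotE.
  have := support_le _ _ _ C0 Cr; have := le_support _ _ (- y) cC Cx.
  have := Cp y; rewrite /skewness dotNr.
  set a := support C y; set b := support C (- y); lra.
have [x Cx] := C0; exists p; split.
  have -> : p = 2^-1 *: x + (1 - 2^-1) *: (p *+ 2 - x).
    by apply/rowP => i; rewrite !mxE; lra.
  by apply: (convex_setP C).1 => //; [exact: reflC|lra].
apply/seteqP; split=> z.
  by move=> Cz; exists (p *+ 2 - z); [exact: reflC|rewrite subKr].
by case=> y Cy <-; exact: reflC.
Qed.

End SupportFunction.

(** * Linearity of the skewness from parkability *)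

Section Parking.
Context {R : realType} {n : nat} (C : set 'rV[R]_n).
Context (C_compact : compact C) (C_nonempty : C !=set0).
Context (C_parkable : forall B : set 'rV[R]_n,
  compact B -> convex_set B -> centrally_symmetric B ->
  forall u : 'rV[R]_n, translate C u `<=` B -> parkable (translate C u) B).
Implicit Types (u x y z w : 'rV[R]_n).

(** The parked translate contains [0 = c + u + v] for some [c] in [C], so it is [C - c]. *)
Lemma parkable_support u : exists2 c, C c & forall x y, C x ->
  dot x y - dot c y <=
    Num.max (support C y + dot u y) (support C (- y) - dot u y).
Proof.
pose S y := Num.max (support C y + dot u y) (support C (- y) - dot u y).
have [||cB convB symB] := @halfspace_body R n S.
- move=> y; rewrite /S le_max.
  have := support_subN_ge0 _ y C_compact C_nonempty.
  set a := support C y; set b := support C (- y).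
  have [//|/=] := leP 0 (a + dot u y); lra.
- by move=> y; rewrite /S maxC opprK dotNr opprK.
have [|v [[_ [c Cc <-] cuv0] CB]] := C_parkable _ cB convB symB u.
  move=> _ [x Cx <-] y; rewrite dotDl /S le_max lerD2r.
  by rewrite le_support.
exists c => // x y Cx; rewrite -dotNl -dotDl.
have -> : x - c = x + u + v.
  rewrite -addrA; congr (_ + _); apply/esym/eqP.
  by rewrite -subr_eq0 opprK [eqbLHS]addrC addrA cuv0.
by apply: CB; exists (x + u) => //; exists x.
Qed.

(** The vector [c] depends on [t] but not on [y], and [K] does not depend on [t]. *)
Lemma skewness_approx_linear w : w != 0 -> exists K : 'rV[R]_n -> R,
  forall t, 0 < t -> exists c, forall y, dot w y = 0 ->
  `|skewness C y - 2 * dot c y| <= K y / t.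
Proof.
move=> w0; have ww := dot_gt0 w w0.
pose M := `|support C w| + `|support C (- w)|.
have CM x : C x -> `|dot x w| <= M.
  move=> Cx; rewrite ler_norml /M.
  have := le_support _ _ w C_compact Cx; have := le_support _ _ (- w) C_compact Cx.
  have := ler_norm (support C w); have := ler_norm (support C (- w)).
  have := normr_ge0 (support C w); have := normr_ge0 (support C (- w)).
  rewrite dotNr; lra.
pose K y := 3 * M * `|skewness C y| / dot w w.
exists K => t t0.
have [c Cc Hc] := parkable_support (t *: w).
exists c.
(* The other half of the absolute value is this bound at [- y]. *)
suff le y : dot w y = 0 -> skewness C y - 2 * dot c y <= K y / t.
  move=> y wy; rewrite ler_norml lerNl le//.
  have := le (- y); rewrite dotNr wy oppr0 => /(_ erefl).
  rewrite /K skewnessN normrN dotNr; lra.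
move=> wy.
(* [y + l w] is the direction in which both terms of the maximum in
   [parkable_support] are close to [(support C y + support C (- y)) / 2]. *)
pose l := - skewness C y / (2 * t * dot w w).
pose e := `|l| * M.
have le_e x : C x -> `|l * dot x w| <= e.
  by move=> Cx; rewrite normrM ler_wpM2l// CM.
have -> : K y / t = 6 * e.
  rewrite /e /l normrM normrN normfV (@gtr0_norm _ (2 * t * _)) ?mulr_gt0//.
  by rewrite /K; field; rewrite !gt_eqF.
have sup1 : support C (y + l *: w) <= support C y + e.
  apply: support_le => // x Cx; rewrite !dotE.
  have := le_e _ Cx; have := le_support _ _ y C_compact Cx.
  rewrite ler_norml; lra.
have sup2 : support C (- (y + l *: w)) <= support C (- y) + e.
  apply: support_le => // x Cx; have := le_support _ _ (- y) C_compact Cx.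
  rewrite !dotE; have := le_e _ Cx; rewrite ler_norml; lra.
have uy : dot (t *: w) (y + l *: w) = - skewness C y / 2.
  by rewrite !dotE wy /l; field; rewrite !gt_eqF.
(* Replacing [y + l *: w] by [y] costs one [e] each for [x], for [c] and for the support
   function. *)
have : support C y <= dot c y + (support C y + support C (- y)) / 2 + 3 * e.
  apply: support_le => // x Cx; have := Hc x (y + l *: w) Cx.
  rewrite uy !(dotDr, dotZr) => le_max.
  have := le_e _ Cx; have := le_e _ Cc; rewrite !ler_norml.
  move: le_max; rewrite le_max => /orP[]; move: sup1 sup2; rewrite /skewness.
    lra.
  lra.
rewrite /skewness; lra.
Qed.

Lemma le_div_all_eq0 (r k : R) : (forall t, 0 < t -> `|r| <= k / t) -> r = 0.
Proof.
move=> rk; apply/eqP; rewrite -normr_le0 leNgt; apply/negP => r0.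
have k0 : 0 < k by have := rk 1 ltr01; rewrite divr1; exact: lt_le_trans.
have := rk (2 * k / `|r|); rewrite divr_gt0 ?mulr_gt0// => /(_ isT).
have -> : k / (2 * k / `|r|) = `|r| / 2 by field; rewrite !gt_eqF.
lra.
Qed.

(** With [w] orthogonal to both [x] and [y], one [c] serves [x], [y] and [a *: x + y]. Its terms
    cancel, leaving an error of order [1 / t]. *)
Lemma skewness_linear : (2 < n)%N -> forall a x y,
  skewness C (a *: x + y) = a * skewness C x + skewness C y.
Proof.
move=> n2 a x y; have [w [w0 xw yw]] := orthogonal_vector_exists x y n2.
have [K HK] := skewness_approx_linear w w0.
apply/eqP; rewrite -subr_eq0; apply/eqP.
apply: (le_div_all_eq0 _ (K (a *: x + y) + `|a| * K x + K y)) => t t0.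
have [c Hc] := HK t t0.
have Ex := Hc x; rewrite dotC xw in Ex.
have Ey := Hc y; rewrite dotC yw in Ey.
have Exy := Hc (a *: x + y); rewrite !dotE !(dotC w) xw yw mulr0 addr0 in Exy.
move: (Ex erefl) (Ey erefl) (Exy erefl) => {}Ex {}Ey {}Exy.
have {}Ex : `|a * (skewness C x - 2 * dot c x)| <= `|a| * K x / t.
  by rewrite normrM -mulrA ler_wpM2l.
move: Ex Ey Exy; rewrite !mulrDl !ler_norml; lra.
Qed.

End Parking.

Theorem theorem4 (R : realType) (n : nat) (hn : (2 < n)%N) (C : set 'rV[R]_n)
  (C_compact : compact C) (C_convex : convex_set C)
  (C_parkable : forall B : set 'rV[R]_n,
     compact B -> convex_set B -> centrally_symmetric B ->
     forall u : 'rV[R]_n, translate C u `<=` B -> parkable (translate C u) B) :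
  has_center_of_symmetry C.
Proof.
have C0 : C !=set0.
  (* An empty [C] fits into any body, but its parked translate would have to contain 0. *)
  have [||cB convB symB] := @halfspace_body R n (fun=> 0) => //.
  apply/set0P/eqP => CE.
  have [|v [[_ [x Cx _] _] _]] := C_parkable _ cB convB symB 0.
    by move=> z [x]; rewrite CE.
  by rewrite CE in Cx.
have lin := skewness_linear C C_compact C0 C_parkable hn.
have skew0 : skewness C 0 = 0 by rewrite /skewness oppr0 subrr.
(* The center represents the linear form [skewness C / 2] in the standard basis. *)
apply: (linear_skewness_center C (\row_i (skewness C (delta_mx 0 i) / 2))) => // y.
rewrite {1}(row_sum_delta y) /dot big_distrr /=.
apply: (big_rec2 (fun s r => skewness C s = r)) => // i s r _ <-.
by rewrite lin mxE; field.
Qed.
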